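(* Let $X=(x_i)_{i=1}^\infty$ be a coloration, and let $A(X)=(A_n(X))_{n=0}^\infty$ and $P(X)=(P_n(X))_{n=0}^\infty$, where $A_n(X)$ is the number of colored compositions of $n$ with coloration $X$ and $P_n(X)$ is the total number of parts of all these compositions. Then $$P(X)=A(X)*A(X)-A(X),$$ where $*$ is the convolution product; that is, $P_n(X)=\sum_{k=0}^nA_{n-k}(X)A_k(X)-A_n(X)$ for all $n\ge 0$.
   Context: A coloration is a sequence $X=(x_i)_{i=1}^\infty$ of non-negative integers; $x_i$ is the number of available colors of a part of size $i$ (if $x_i=0$, the part $i$ is not used). A colored composition of $n$ with coloration $X$ is a finite ordered sequence of parts, each part being a positive integer $i$ (its size) together with one of its $x_i$ colors, such that the sizes sum to $n$. $L_n(X)$ is the set of colored compositions of $n$ with coloration $X$; $A_n(X)=|L_n(X)|$ for $n\ge1$ and $A_0(X)=1$. For $\mathbf b\in L_n(X)$, $p(\mathbf b)$ is the number of parts of $\mathbf b$, and $P_n(X)=\sum_{\mathbf b\in L_n(X)}p(\mathbf b)$, with $P_0(X)=0$ (no parts are used for $n=0$). For sequences $a=(a_n)_{n\ge0}$, $b=(b_n)_{n\ge 0}$, the convolution product $a*b$ has $n$-th term $\sum_{k=0}^na_{n-k}b_k$. *)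

(* Defs.v *)
From HB Require Import structures.
From mathcomp Require Import all_boot all_order all_algebra.

Set Implicit Arguments.
Unset Strict Implicit.
Unset Printing Implicit Defensive.

Import GRing.Theory.

(* x_i is [X i] for i >= 1; the junk value [X 0] is never used, because
   [colored_comp] only admits parts of positive size. *)
Definition coloration := nat -> nat.

(* A size i together with one of its x_i colors. *)
Definition part (X : coloration) := {i : nat & 'I_(X i)}.

Definition part_size (X : coloration) (p : part X) : nat := tag p.

Definition is_colored_comp (X : coloration) (n : nat) (b : seq (part X)) :=
  all (fun p => 0 < part_size p) b && (\sum_(p <- b) part_size p == n).

(* The set L_n(X). *)
Record colored_comp (X : coloration) (n : nat) := ColoredComp {
  comp_parts :> seq (part X);
  _ : is_colored_comp n comp_parts
}.

HB.instance Definition _ X n := [isSub for @comp_parts X n].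
HB.instance Definition _ X n := [Countable of colored_comp X n by <:].

Section ColoredCompFinite.
Variables (X : coloration) (n : nat).

Let parts : seq (part X) :=
  flatten [seq [seq Tagged (fun i => 'I_(X i)) c | c <- enum 'I_(X i)]
          | i <- iota 0 n.+1].

Let Fixpoint words (m : nat) : seq (seq (part X)) :=
  if m is m'.+1 then [::] :: [seq p :: b | p <- parts, b <- words m']
  else [:: [::]].

Let mem_parts (p : part X) : part_size p <= n -> p \in parts.
Proof.
case: p => i c /= le_in; apply/flatten_mapP; exists i.
  by rewrite mem_iota.
by apply/mapP; exists c; rewrite ?mem_enum.
Qed.

Let mem_words m (b : seq (part X)) :
  all (fun p => 0 < part_size p) b -> \sum_(p <- b) part_size p <= minn m n ->
  b \in words m.
Proof.
elim: m b => [|m IHm] [|p b] //= /andP[p_gt0 b_gt0].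
  by rewrite big_cons min0n leqn0 addn_eq0 eqn0Ngt p_gt0.
rewrite big_cons leq_min => /andP[le_m le_n].
rewrite inE /=; apply: allpairs_f.
  by apply: mem_parts; apply: leq_trans le_n; apply: leq_addr.
apply: IHm => //; rewrite leq_min (leq_trans _ le_n) ?leq_addl // andbT.
by rewrite -ltnS; apply: leq_trans le_m; rewrite -add1n leq_add2r.
Qed.

Let colored_comp_enum : seq (colored_comp X n) := undup (pmap insub (words n)).

Let colored_comp_enumP : Finite.axiom colored_comp_enum.
Proof.
move=> b; rewrite count_uniq_mem ?undup_uniq // mem_undup mem_pmap_sub.
have /andP[b_gt0 /eqP sum_b] := valP b.
by rewrite mem_words // sum_b minnn.
Qed.

HB.instance Definition _ := isFinite.Build (colored_comp X n) colored_comp_enumP.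

End ColoredCompFinite.

Definition num_parts (X : coloration) (n : nat) (b : colored_comp X n) : nat :=
  size b.

Definition A (X : coloration) (n : nat) : nat :=
  if n is 0 then 1 else #|{: colored_comp X n}|.

Definition P (X : coloration) (n : nat) : nat :=
  if n is 0 then 0 else \sum_(b : colored_comp X n) num_parts b.

Definition convolution (R : pzSemiRingType) (a b : nat -> R) (n : nat) : R :=
  (\sum_(k < n.+1) a (n - k)%N * b k)%R.

(* Main.v *)
Require Import Defs.
From mathcomp Require Import all_boot all_order all_algebra.

(** The identity is equivalent to P + A = A * A, and P_n + A_n is the sum over
    the colored compositions b of n of p(b) + 1.  Now p(b) + 1 is the number of
    ways of cutting b into a prefix u and a suffix v, either of which may be
    empty.  If v sums to k, then u sums to n - k; conversely any composition of
    n - k followed by any composition of k is a composition of n with a marked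
    cut.  So the marked compositions are also counted by
    \sum_k A_(n - k) A_k.

    To avoid comparing elements of the types [colored_comp X (n - k)] for
    different k, both families are listed as duplicate-free sequences of pairs
    (u, v) of plain words ([cuts] and [joins]); the two sequences have the same
    elements, namely the pairs for which u ++ v is a composition of n, hence the
    same size ([size_cuts_joins]). *)

Import GRing.Theory.

Section Cuts.
Variable X : coloration.
Implicit Types (n k : nat) (b u v : seq (part X)).

Definition comps n : seq (seq (part X)) :=
  [seq val c | c <- enum {: colored_comp X n}].

Lemma mem_comps n b : (b \in comps n) = is_colored_comp n b.
Proof.
apply/mapP/idP => [[c _ ->]|b_comp]; first exact: valP c.
by exists (ColoredComp b_comp); rewrite ?mem_enum.
Qed.

Lemma comps_uniq n : uniq (comps n).
Proof. by rewrite map_inj_uniq ?enum_uniq //; apply: val_inj. Qed.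

Lemma colored_comp_cat n k u v :
  is_colored_comp n u -> is_colored_comp k v -> is_colored_comp (n + k) (u ++ v).
Proof.
rewrite /is_colored_comp all_cat big_cat /=.
by move=> /andP[-> /eqP->] /andP[-> /eqP->] /=.
Qed.

Lemma colored_comp_split n u v :
  is_colored_comp n (u ++ v) ->
  exists2 k, k <= n & is_colored_comp (n - k) u && is_colored_comp k v.
Proof.
rewrite /is_colored_comp all_cat big_cat /= => /andP[/andP[-> ->] /eqP <-].
by exists (\sum_(p <- v) part_size p); rewrite ?leq_addl // addnK !eqxx.
Qed.

(** The convention A_0 = 1 agrees with the general count: the empty word is the
    only composition of 0, its parts being positive. *)
Lemma comps0 : comps 0 = [:: [::]].
Proof.
apply/perm_small_eq => //; apply: uniq_perm; rewrite ?comps_uniq // => b.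
rewrite mem_comps inE /is_colored_comp.
case: b => [|p b]; first by rewrite big_nil.
by rewrite big_cons addn_eq0 /=; case: (part_size p) => [|m] //=; rewrite andbF.
Qed.

Lemma size_comps n : size (comps n) = A X n.
Proof. by case: n => [|n]; rewrite ?comps0 // size_map -cardE. Qed.

Lemma sum_size_comps n : \sum_(b <- comps n) size b = P X n.
Proof.
case: n => [|n]; first by rewrite comps0 big_seq1.
by rewrite big_map big_enum.
Qed.

Definition cuts n : seq (seq (part X) * seq (part X)) :=
  [seq (take i b, drop i b) | b <- comps n, i <- iota 0 (size b).+1].

Definition joins n : seq (seq (part X) * seq (part X)) :=
  [seq uv | k <- iota 0 n.+1,
            uv <- [seq (u, v) | u <- comps (n - k), v <- comps k]].

Lemma mem_cuts n u v : ((u, v) \in cuts n) = is_colored_comp n (u ++ v).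
Proof.
apply/allpairsPdep/idP => [[b [i [b_comp _ [-> ->]]]]|uv_comp].
  by rewrite cat_take_drop -mem_comps.
exists (u ++ v), (size u); split; first by rewrite mem_comps.
- by rewrite mem_iota /= add0n ltnS size_cat leq_addr.
- by rewrite take_size_cat // drop_size_cat.
Qed.

Lemma mem_joins n u v : ((u, v) \in joins n) = is_colored_comp n (u ++ v).
Proof.
apply/allpairsPdep/idP => [[k [_ [k_le /allpairsP[[a c] /= [a_comp c_comp ->]]]]]|].
  move=> [-> ->]; move: k_le; rewrite mem_iota /= add0n ltnS => k_le.
  by rewrite -(subnK k_le) colored_comp_cat -?mem_comps.
move=> /colored_comp_split[k k_le /andP[u_comp v_comp]].
exists k, (u, v); split=> //; first by rewrite mem_iota.
by apply/allpairsP; exists (u, v); rewrite !mem_comps.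
Qed.

(** A cut determines its word by concatenation and its position by the length
    of the prefix; the bound on i matters since [take] truncates. *)
Lemma cuts_uniq n : uniq (cuts n).
Proof.
apply: allpairs_uniq_dep => [|b _|]; [exact: comps_uniq|exact: iota_uniq|].
move=> s t /allpairsPdep[b [i [_ i_le ->]]] /allpairsPdep[c [j [_ j_le ->]]] /=.
move: i_le j_le; rewrite !mem_iota /= !add0n !ltnS => i_le j_le [eq_take eq_drop].
have eq_bc : b = c by rewrite -(cat_take_drop i b) eq_take eq_drop cat_take_drop.
move: eq_take j_le; rewrite -eq_bc => /(congr1 size).
by move=> + j_le; rewrite !size_takel // => ->.
Qed.

(** The index k is recovered from a pair as the sum of the suffix. *)
Lemma joins_uniq n : uniq (joins n).
Proof.
apply: allpairs_uniq_dep => [|k _|]; first exact: iota_uniq.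
  by apply: allpairs_uniq => [||[u v] [u' v'] _ _ []-> ->]; rewrite ?comps_uniq.
have sum_suffix k uv : uv \in [seq (u, v) | u <- comps (n - k), v <- comps k] ->
    \sum_(p <- uv.2) part_size p = k.
  case/allpairsP=> [[u v] /= [_ v_comp ->]] /=.
  by move: v_comp; rewrite mem_comps => /andP[_ /eqP].
move=> s t /allpairsPdep[k [uv [_ k_uv ->]]] /allpairsPdep[l [uv' [_ l_uv ->]]] /=.
move=> eq_uv; move: l_uv; rewrite -eq_uv => /sum_suffix.
by rewrite (sum_suffix k) // => ->.
Qed.

Lemma size_cuts_joins n : size (cuts n) = size (joins n).
Proof.
apply/perm_size/uniq_perm; rewrite ?cuts_uniq ?joins_uniq // => -[u v].
by rewrite mem_cuts mem_joins.
Qed.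

Lemma size_cuts n : size (cuts n) = P X n + A X n.
Proof.
rewrite size_allpairs_dep sumnE big_map -sum_size_comps -size_comps -sum1_size.
by rewrite -big_split; apply: eq_bigr => b _; rewrite size_iota -addn1.
Qed.

Lemma size_joins n : size (joins n) = \sum_(k < n.+1) A X (n - k) * A X k.
Proof.
rewrite size_allpairs_dep sumnE big_map -[iota _ _]/(index_iota 0 n.+1) big_mkord.
by apply: eq_bigr => k _; rewrite size_allpairs !size_comps.
Qed.

End Cuts.

Local Open Scope ring_scope.

Theorem corollary4 (X : coloration) (n : nat) :
  (P X n)%:Z =
    convolution (fun k => (A X k)%:Z) (fun k => (A X k)%:Z) n - (A X n)%:Z.
Proof.
have : (P X n + A X n)%N%:Z = (\sum_(k < n.+1) A X (n - k) * A X k)%N%:Z.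
  by rewrite -size_cuts size_cuts_joins size_joins.
rewrite PoszD -[in RHS]natz natr_sum /convolution => PA_conv.
apply/eqP; rewrite -subr_eq opprK PA_conv; apply/eqP/eq_bigr => k _.
by rewrite natz PoszM.
Qed.
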